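(* Let $\mathcal{A}\subseteq\Sigma^{<\omega}$ be the set of all acyclic well-formed formulae of set theory, regarded as strings over the alphabet $\Sigma=\{[,\ ],\ \to,\ \forall,\ \doteq,\ \in,\ w,\ \circledast,\ \bot\}$. Then $\mathcal{A}$ is not a context-free language.
   Context: A formal language over a finite alphabet $\Sigma$ is a subset of $\Sigma^{<\omega}$, the set of finite strings over $\Sigma$. A language is context-free if it is the set of all terminal strings generated from the start symbol of some context-free grammar (finite sets of nonterminals and production rules, each rule replacing a single nonterminal by a finite string of terminals and nonterminals). Syntax of set theory: the alphabet consists of the nine symbols $[$, $]$, $\to$, $\forall$, $\doteq$ (equality symbol), $\in$, $w$, $\circledast$, $\bot$. Well-formed formulae are strings defined as follows. (1) Variables: $w$ is a variable; if $\alpha$ is a variable then the string $\alpha\circledast$ is a variable (so the variables are exactly the strings $w\circledast^n$, $n\in\mathbb{N}$). (2) Atomic formulae: $\bot$ is an atomic formula; if $\alpha,\beta$ are variables then $\alpha\doteq\beta$ and $\alpha\in\beta$ are atomic formulae. (3) Formulae: every atomic formula is a formula; if $\varphi,\psi$ are formulae and $\alpha$ is a variable then $[\forall\alpha]\varphi$ and $[\varphi\to\psi]$ are formulae. A formula $\varphi$ is acyclic if: (1) for each variable $x$ appearing in $\varphi$, either all occurrences of $x$ are free or all occurrences of $x$ are bound by the same quantifier; and (2) there is no $n\geq 1$, sequence of variables $\langle x_i\mid 0\leq i\leq n\rangle$ and sequence of atomic formulae $\langle\alpha_i\mid 0\leq i<n\rangle$ appearing as distinct subformulae of $\varphi$ such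 that $x_0$ and $x_n$ are the same variable and, for all $i<n$, $\alpha_i$ is of the form $x_i\doteq x_{i+1}$, $x_{i+1}\doteq x_i$, $x_i\in x_{i+1}$, or $x_{i+1}\in x_i$. (In particular, with $n=1$, a formula containing $x\doteq x$ is not acyclic.) *)

(* Defs.v *)
From HB Require Import structures.
From mathcomp Require Import all_boot.
From Stdlib Require Import Relation_Operators.

Set Implicit Arguments.
Unset Strict Implicit.
Unset Printing Implicit Defensive.

Definition language (S : finType) := seq S -> Prop.

Record cfg (S : finType) := CFG {
  nonterminal : finType;
  start : nonterminal;
  rules : seq (nonterminal * seq (nonterminal + S))
}.

Definition cfg_step (S : finType) (G : cfg S)
    (s t : seq (nonterminal G + S)) : Prop :=
  exists A r u v, [/\ (A, r) \in rules G,
                      s = u ++ inl A :: v & t = u ++ r ++ v].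

Definition generates (S : finType) (G : cfg S) : language S :=
  fun s => clos_refl_trans _ (@cfg_step S G) [:: inl (start G)] (map inr s).

Definition context_free (S : finType) (L : language S) : Prop :=
  exists G : cfg S, forall s, L s <-> generates G s.

Inductive symbol :=
  Lbr | Rbr | Arrow | Forall | DotEq | In | W | Star | Bot.

Definition symbols : seq symbol :=
  [:: Lbr; Rbr; Arrow; Forall; DotEq; In; W; Star; Bot].

Definition symbol_code (a : symbol) : 'I_9 :=
  match a with
  | Lbr => @Ordinal 9 0 isT | Rbr => @Ordinal 9 1 isT
  | Arrow => @Ordinal 9 2 isT | Forall => @Ordinal 9 3 isT
  | DotEq => @Ordinal 9 4 isT | In => @Ordinal 9 5 isT
  | W => @Ordinal 9 6 isT | Star => @Ordinal 9 7 isT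
  | Bot => @Ordinal 9 8 isT
  end.

Lemma symbol_codeK :
  cancel symbol_code (fun i : 'I_9 => nth Bot symbols i).
Proof. by case. Qed.

HB.instance Definition _ := Finite.copy symbol (can_type symbol_codeK).

Inductive is_variable : seq symbol -> Prop :=
  | is_variable_w : is_variable [:: W]
  | is_variable_star a : is_variable a -> is_variable (rcons a Star).

Inductive is_atomic : seq symbol -> Prop :=
  | is_atomic_bot : is_atomic [:: Bot]
  | is_atomic_eq a b :
      is_variable a -> is_variable b -> is_atomic (a ++ DotEq :: b)
  | is_atomic_in a b :
      is_variable a -> is_variable b -> is_atomic (a ++ In :: b).

Inductive is_formula : seq symbol -> Prop :=
  | is_formula_atomic f : is_atomic f -> is_formula f
  | is_formula_all a f : is_variable a -> is_formula f ->
      is_formula ([:: Lbr; Forall] ++ a ++ [:: Rbr] ++ f)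
  | is_formula_imp f g : is_formula f -> is_formula g ->
      is_formula ([:: Lbr] ++ f ++ [:: Arrow] ++ g ++ [:: Rbr]).

(* Parse trees; the number n stands for the variable W Star^n. By
   [is_formulaP] and [string_of_inj] below, [string_of] is a bijection from
   parse trees onto the well-formed strings, so subformulae and variable
   occurrences of a string can be read off its unique tree. *)

Inductive formula :=
  | FBot
  | FEq (x y : nat)
  | FIn (x y : nat)
  | FAll (x : nat) (f : formula)
  | FImp (f g : formula).

Definition string_of_var (n : nat) : seq symbol := W :: nseq n Star.

Fixpoint string_of (f : formula) : seq symbol :=
  match f with
  | FBot => [:: Bot]
  | FEq x y => string_of_var x ++ DotEq :: string_of_var y
  | FIn x y => string_of_var x ++ In :: string_of_var y
  | FAll x g => [:: Lbr; Forall] ++ string_of_var x ++ [:: Rbr] ++ string_of g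
  | FImp g h =>
      [:: Lbr] ++ string_of g ++ [:: Arrow] ++ string_of h ++ [:: Rbr]
  end.

Lemma is_variableP a : is_variable a <-> exists n, a = string_of_var n.
Proof.
have varS n : string_of_var n.+1 = rcons (string_of_var n) Star.
  by rewrite /string_of_var -addn1 nseqD /= cats1.
split=> [|[n ->]].
  elim=> [|b _ [n ->]]; first by exists 0.
  by exists n.+1; rewrite varS.
elim: n => [|n IHn]; first exact: is_variable_w.
by rewrite varS; apply: is_variable_star.
Qed.

Lemma is_formulaP s : is_formula s <-> exists f, s = string_of f.
Proof.
split=> [|[f ->]].
  elim=> [_ [|a b|a b]|a g|g h _ + _ +].
  - by exists FBot.
  - by move=> /is_variableP[x ->] /is_variableP[y ->]; exists (FEq x y).
  - by move=> /is_variableP[x ->] /is_variableP[y ->]; exists (FIn x y).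
  - by move=> /is_variableP[x ->] _ [f ->]; exists (FAll x f).
  - by case=> [f ->] [f' ->]; exists (FImp f f').
have var n : is_variable (string_of_var n) by apply/is_variableP; exists n.
elim: f => [|x y|x y|x f IHf|f IHf g IHg].
- exact/is_formula_atomic/is_atomic_bot.
- exact/is_formula_atomic/is_atomic_eq.
- exact/is_formula_atomic/is_atomic_in.
- exact: is_formula_all.
- exact: is_formula_imp.
Qed.

Lemma string_of_var_cat_inj m n s t :
    string_of_var m ++ s = string_of_var n ++ t ->
  head Bot s != Star -> head Bot t != Star -> m = n /\ s = t.
Proof.
case=> + hs ht; elim: m n => [|m IHm] [|n] /=.
- by [].
- by move=> es; rewrite es eqxx in hs.
- by move=> et; rewrite -et eqxx in ht.
- by case=> /IHm[-> ->].
Qed.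

Lemma string_of_cat_inj f g s t :
    string_of f ++ s = string_of g ++ t ->
  head Bot s != Star -> head Bot t != Star -> f = g /\ s = t.
Proof.
elim: f g s t => [|x y|x y|x f IHf|f1 IH1 f2 IH2]
  [|x' y'|x' y'|x' g|g1 g2] s t;
  rewrite {1 2}/string_of -/string_of -?catA ?cat_cons //.
- by case.
- move=> /string_of_var_cat_inj/(_ isT isT)[-> []].
  move=> /(congr1 (cons W))/string_of_var_cat_inj inj hs ht.
  by case: inj => // -> ->.
- by move=> /string_of_var_cat_inj/(_ isT isT)[].
- by move=> /string_of_var_cat_inj/(_ isT isT)[].
- move=> /string_of_var_cat_inj/(_ isT isT)[-> []].
  move=> /(congr1 (cons W))/string_of_var_cat_inj inj hs ht.
  by case: inj => // -> ->.
- case=> /(congr1 (cons W)).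
  move=> /string_of_var_cat_inj/(_ isT isT)[-> []].
  move=> /IHf inj hs ht.
  by case: inj => // -> ->.
- by case; case: g1.
- by case; case: f1 {IH1}.
- case; rewrite -?catA => /IH1/(_ isT isT)[-> []]; rewrite -?catA.
  by move=> /IH2/(_ isT isT)[-> []].
Qed.

Lemma string_of_inj : injective string_of.
Proof.
move=> f g efg.
have /string_of_cat_inj/(_ isT isT)[//] :
  string_of f ++ [::] = string_of g ++ [::] by rewrite efg.
Qed.

(* Occurrences of subformulae are addressed by paths from the root, where
   [false] enters the body of a quantifier or the left side of an implication
   and [true] its right side. Equal formulae at different addresses are
   distinct occurrences. *)

Fixpoint subformula_at (f : formula) (p : seq bool) : option formula :=
  match p, f with
  | [::], _ => Some f
  | false :: p', FAll _ g => subformula_at g p'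
  | false :: p', FImp g _ => subformula_at g p'
  | true :: p', FImp _ h => subformula_at h p'
  | _, _ => None
  end.

Definition node_variables (f : formula) : seq nat :=
  match f with
  | FEq x y | FIn x y => [:: x; y]
  | FAll x _ => [:: x]
  | FBot | FImp _ _ => [::]
  end.

(* The variable following a quantifier symbol counts as an occurrence. *)
Definition occurs_at (f : formula) (x : nat) (p : seq bool) : Prop :=
  exists2 g, subformula_at f p = Some g & x \in node_variables g.

(* The quantifier at q is on x and has the address p in its scope; q = p is
   allowed, so that the variable in the quantifier itself is bound by it. *)
Definition quantifier_over (f : formula) (x : nat) (q p : seq bool) : Prop :=
  prefix q p /\ exists g, subformula_at f q = Some (FAll x g).

Definition free_at (f : formula) (x : nat) (p : seq bool) : Prop :=
  forall q, ~ quantifier_over f x q p.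

(* An occurrence is bound by the innermost such quantifier. *)
Definition bound_at_by (f : formula) (x : nat) (p q : seq bool) : Prop :=
  quantifier_over f x q p /\
  forall q', quantifier_over f x q' p -> prefix q' q.

Definition uniformly_bound (f : formula) : Prop :=
  forall x,
    (forall p, occurs_at f x p -> free_at f x p) \/
    (exists q, forall p, occurs_at f x p -> bound_at_by f x p q).

Definition links (a : formula) (x y : nat) : Prop :=
  a = FEq x y \/ a = FEq y x \/ a = FIn x y \/ a = FIn y x.

Definition has_cycle (f : formula) : Prop :=
  exists (n : nat) (x : nat -> nat) (p : nat -> seq bool),
    [/\ 1 <= n,
        x 0 = x n,
        {in gtn n &, injective p} &
        forall i, i < n ->
          exists2 a, subformula_at f (p i) = Some a & links a (x i) (x i.+1)].

Definition acyclic (f : formula) : Prop :=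
  uniformly_bound f /\ ~ has_cycle f.

Definition acyclic_formulae : language symbol :=
  fun s => exists2 f : formula, s = string_of f & acyclic f.

(* Main.v *)
(* The towers of quantifiers [forall x_1]...[forall x_m] Bot are acyclic exactly
   when the x_i are pairwise distinct. Such a formula has m occurrences of the
   symbol W and at least 0 + 1 + ... + (m - 1) = 'C(m, 2) Stars, with equality
   for the tower on the variables 0, ..., m - 1. Pump that tower. If the pumped
   factors contain W, then pumping up makes the number of Stars grow linearly
   and the number of variables at least linearly, which violates the quadratic
   bound. Otherwise pumping down preserves m and shortens a string that already
   has the least possible number of Stars. Hence no bound on the length of the
   pumped factors is needed. *)

Require Import Defs.
From mathcomp Require Import all_boot.
From mathcomp Require Import zify.
From Stdlib Require Import Relation_Operators Operators_Properties.

Set Implicit Arguments.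
Unset Strict Implicit.
Unset Printing Implicit Defensive.

(** * Pumping for context-free grammars *)

Section Pumping.

Variables (S : finType) (G : cfg S).

Local Notation form := (seq (nonterminal G + S)).
Local Notation step := (@cfg_step S G).
Local Notation derives := (clos_refl_trans form step).
Local Notation term w := (map inr w : form).

Lemma derives_context (u v s t : form) :
  derives s t -> derives (u ++ s ++ v) (u ++ t ++ v).
Proof.
elim=> [{}s {}t [A [r [u' [v' [rG -> ->]]]]] | {}s | s1 s2 s3 _ IH1 _ IH2].
- apply: rt_step; exists A, r, (u ++ u'), (v' ++ v).
  by split; rewrite ?catA //= -!catA.
- exact: rt_refl.
- exact: rt_trans IH1 IH2.
Qed.

Lemma derives_cat (s s' t t' : form) :
  derives s s' -> derives t t' -> derives (s ++ t) (s' ++ t').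
Proof.
move=> /(derives_context [::] t) ss' /(derives_context s' [::]).
by rewrite !cats0; apply: rt_trans.
Qed.

Lemma derives_rule (A : nonterminal G) (r : form) :
  (A, r) \in rules G -> derives [:: inl A] r.
Proof.
by move=> rG; apply: rt_step; exists A, r, [::], [::]; split; rewrite ?cats0.
Qed.

(* [path_free X s w]: s derives w by a forest of derivation trees in which no
   nonterminal is repeated along a branch and none belongs to X. *)
Inductive path_free (X : {set nonterminal G}) : form -> seq S -> Prop :=
  | path_free_nil : path_free X [::] [::]
  | path_free_term a s w :
      path_free X s w -> path_free X (inr a :: s) (a :: w)
  | path_free_rule A r s w1 w2 :
      A \notin X -> (A, r) \in rules G ->
      path_free (A |: X) r w1 -> path_free X s w2 ->
      path_free X (inl A :: s) (w1 ++ w2).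

Lemma path_free_derives X s w : path_free X s w -> derives s (term w).
Proof.
elim=> [{}X | {}X a {}s {}w _ IH | {}X A r {}s w1 w2 _ rG _ IH1 _ IH2].
- exact: rt_refl.
- by apply: (@derives_cat [:: inr a] [:: inr a]) => //; apply: rt_refl.
- rewrite map_cat; apply: (@derives_cat [:: inl A]) => //.
  exact: rt_trans (derives_rule rG) IH1.
Qed.

Lemma path_free_term_refl X w : path_free X (term w) w.
Proof.
elim: w => [|a w IH]; [exact: path_free_nil | exact: path_free_term].
Qed.

Lemma path_freeW (X Y : {set nonterminal G}) s w :
  Y \subset X -> path_free X s w -> path_free Y s w.
Proof.
move=> + sw; elim: sw Y => {X s w}
  [X | X a s w _ IH | X A r s w1 w2 AX rG _ IH1 _ IH2] Y YX.
- exact: path_free_nil.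
- exact/path_free_term/IH.
- apply: (path_free_rule _ rG); last exact: IH2.
    by apply: contra AX; apply: (subsetP YX).
  exact/IH1/setUS.
Qed.

Lemma path_free_cat X s t w1 w2 :
  path_free X s w1 -> path_free X t w2 -> path_free X (s ++ t) (w1 ++ w2).
Proof.
elim=> {X s w1} [// | X a s w _ IH tw | X A r s w w' AX rG rw _ _ IH tw].
  exact/path_free_term/IH.
by rewrite /= -catA; apply: path_free_rule AX rG rw _; apply: IH.
Qed.

Lemma path_free_catP X s t w : path_free X (s ++ t) w ->
  exists w1 w2, [/\ w = w1 ++ w2, path_free X s w1 & path_free X t w2].
Proof.
elim: s w => [|[A|a] s IH] w /=; first by exists [::], w; split=> //; constructor.
- move=> sw; inversion sw as [| |B r s' v1 v2 AX rG rv1 sv2]; subst.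
  have [w1 [w2 [-> sw1 tw2]]] := IH _ sv2.
  exists (v1 ++ w1), w2; rewrite catA; split=> //.
  exact: path_free_rule AX rG rv1 sw1.
- move=> sw; inversion sw as [|b s' v sv|]; subst.
  have [w1 [w2 [-> sw1 tw2]]] := IH _ sv.
  by exists (a :: w1), w2; split=> //; apply: path_free_term.
Qed.

(** Each rule moves one nonterminal into [X], so a branch applies at most [#|~: X|] rules, and each
    level multiplies the length by at most [B]. *)
Lemma path_free_size X s w B :
    0 < B -> (forall A r, (A, r) \in rules G -> size r <= B) ->
  path_free X s w -> size w <= size s * B ^ #|~: X|.
Proof.
move=> B_gt0 leB.
elim=> {X s w} [// | X a s w _ IH | X A r s w1 w2 AX rG _ IH1 _ IH2] /=.
  by rewrite mulSn -add1n leq_add // expn_gt0 B_gt0.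
rewrite size_cat mulSn leq_add // (leq_trans IH1) //.
have -> : #|~: X| = #|~: (A |: X)|.+1.
  by rewrite (cardsD1 A) inE AX setCU setIC -setDE.
by rewrite expnS leq_mul // (leB A).
Qed.

(** Either [A] labels no node of the forest, or the forest is cut at the first such node in
    preorder: [x] is the yield of its subtree, [v] and [y] are what surrounds it. *)
Lemma path_free_extend X s w A : path_free X s w ->
  path_free (A |: X) s w \/
  exists v x y, [/\ w = v ++ x ++ y,
    derives s (term v ++ inl A :: term y) & path_free X [:: inl A] x].
Proof.
elim=> {X s w} [X | X a s w _ IH | X B r s w1 w2 BX rG rw1 IH1 sw2 IH2].
- by left; constructor.
- case: IH => [sw | [v [x [y [-> sA Ax]]]]].
    by left; apply: path_free_term.
  right; exists (a :: v), x, y; split=> //.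
  by apply: (@derives_cat [:: inr a] [:: inr a]) => //; apply: rt_refl.
have Bw1 : derives [:: inl B] (term w1).
  exact: rt_trans (derives_rule rG) (path_free_derives rw1).
have [eqAB | neqAB] := eqVneq B A.
  subst B; right; exists [::], w1, w2; split=> //.
    apply: (@derives_cat [:: inl A] [:: inl A]) (path_free_derives sw2).
    exact: rt_refl.
  rewrite -[w1]cats0; apply: path_free_rule BX rG rw1 _.
  exact: path_free_nil.
case: IH1 => [rw1A | [v [x [y [-> rA Ax]]]]]; last first.
  right; exists v, x, (y ++ w2); rewrite -!catA; split=> //.
    rewrite map_cat -cat_cons catA.
    apply: (@derives_cat [:: inl B]) (path_free_derives sw2).
    exact: rt_trans (derives_rule rG) rA.
  exact: path_freeW (subsetUr _ _) Ax.
case: IH2 => [sw2A | [v [x [y [-> sA Ax]]]]]; last first.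
  right; exists (w1 ++ v), x, y; rewrite -!catA; split=> //.
  by rewrite map_cat -catA; apply: (@derives_cat [:: inl B]).
left; apply: path_free_rule _ rG _ sw2A; last by rewrite setUCA.
by rewrite !inE negb_or neqAB.
Qed.

Definition pumpable (s : form) (w : seq S) : Prop :=
  exists A u v x y z, [/\ w = u ++ v ++ x ++ y ++ z, v ++ y <> [::],
    derives s (term u ++ inl A :: term z),
    derives [:: inl A] (term v ++ inl A :: term y) &
    derives [:: inl A] (term x)].

(* Induction on the derivation from its end. When the rule A -> r is added at
   the root of a forest without repetitions, an occurrence of A below r either
   pumps a nonempty context or has the same yield as the new root, and then
   replaces it. *)
Lemma derives_pumpable_or_path_free s w :
  derives s (term w) -> pumpable s w \/ path_free set0 s w.
Proof.
move e: (term w) => t /(clos_rt_rt1n _ _ _ _) sw.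
elim: sw e => {s t} [s <- | s s' t ss' _ IH e]; first by right; apply: path_free_term_refl.
case: (IH e) => [[A [u [v [x [y [z [-> vy sA AA Ax]]]]]]] | ].
  left; exists A, u, v, x, y, z; split=> //.
  exact: rt_trans (rt_step _ _ _ _ ss') sA.
case: ss' => A [r [u [v [rG -> ->]]]].
move=> /path_free_catP[w1 [w' [-> uw1]]] /path_free_catP[w2 [w3 [-> rw2 vw3]]].
have build : path_free set0 [:: inl A] w2 ->
    path_free set0 (u ++ inl A :: v) (w1 ++ w2 ++ w3).
  move=> Aw2; apply: path_free_cat uw1 _.
  exact: (@path_free_cat _ [:: inl A]).
case: (path_free_extend A rw2) => [rw2A | [v' [x [y [ew2 rA Ax]]]]].
  right; apply: build; rewrite -[w2]cats0.
  by apply: path_free_rule _ rG rw2A _; rewrite ?inE //; apply: path_free_nil.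
have [/eqP | vy] := altP (v' ++ y =P [::]).
  rewrite -size_eq0 size_cat addn_eq0 !size_eq0 => /andP[/eqP v0 /eqP y0].
  by right; apply: build; rewrite ew2 v0 y0 cats0.
left; exists A, w1, v', x, y, w3; split.
- by rewrite ew2 -!catA.
- exact/eqP.
- apply: derives_cat (path_free_derives uw1) _.
  apply: (@derives_cat [:: inl A] [:: inl A]) (path_free_derives vw3).
  exact: rt_refl.
- exact: rt_trans (derives_rule rG) rA.
- exact: path_free_derives Ax.
Qed.

Lemma derives_pump (A : nonterminal G) v y k :
    derives [:: inl A] (term v ++ inl A :: term y) ->
  derives [:: inl A]
    (term (flatten (nseq k v)) ++ inl A :: term (flatten (nseq k y))).
Proof.
move=> AA; elim: k => [|k IH] /=; first exact: rt_refl.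
(* Unfolding [nseq] puts the new [y] first, while the outer context produces it last. *)
have -> : y ++ flatten (nseq k y) = flatten (nseq k y) ++ y.
  by rewrite -[LHS]/(flatten (nseq k.+1 y)) -addn1 nseqD flatten_cat /= cats0.
apply: rt_trans AA _; rewrite !map_cat -catA.
have := derives_context (term v) (term y) IH.
by rewrite /= -!catA.
Qed.

Lemma generates_pumping : exists N, forall s, generates G s -> N < size s ->
  exists u v x y z, [/\ s = u ++ v ++ x ++ y ++ z, v ++ y <> [::] &
    forall k, generates G (u ++ flatten (nseq k v) ++ x ++
                           flatten (nseq k y) ++ z)].
Proof.
pose B := \max_(p <- rules G) (size p.2).+1.
(* This bounds every repetition-free yield of the start symbol. The successor keeps the base
   positive even for an empty list of rules. *)
exists (B.+1 ^ #|nonterminal G|) => s /derives_pumpable_or_path_free[]; last first.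
  move=> /(@path_free_size _ _ _ B.+1 isT); rewrite mul1n setC0 cardsT leqNgt.
  move=> bound long; rewrite long in bound; apply: False_ind.
  suff leB A r : (A, r) \in rules G -> size r <= B.+1 by have := bound leB.
  move=> rG; have := @leq_bigmax_seq _ (rules G) xpredT (fun p => (size p.2).+1) _ rG isT.
  by rewrite -/B /=; lia.
case=> A [u [v [x [y [z [es vy sA AA Ax]]]]]] _.
exists u, v, x, y, z; split=> // k; apply: rt_trans sA _.
rewrite !map_cat; apply: derives_cat; first exact: rt_refl.
rewrite !catA; apply: (@derives_cat [:: inl A]); last exact: rt_refl.
apply: rt_trans (derives_pump k AA) _; rewrite -catA.
apply: derives_cat; first exact: rt_refl.
by apply: (@derives_cat [:: inl A]) => //; apply: rt_refl.
Qed.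

End Pumping.

Lemma context_free_pumping (S : finType) (L : language S) : context_free L ->
  exists N, forall s, L s -> N < size s ->
  exists u v x y z, [/\ s = u ++ v ++ x ++ y ++ z, v ++ y <> [::] &
    forall k, L (u ++ flatten (nseq k v) ++ x ++ flatten (nseq k y) ++ z)].
Proof.
case=> G LG; have [N pump] := generates_pumping G; exists N => s /LG Gs Ns.
have [u [v [x [y [z [es vy Gk]]]]]] := pump s Gs Ns.
by exists u, v, x, y, z; split=> // k; apply/LG.
Qed.

Lemma count_pumped (T : Type) (P : pred T) (u v x y z : seq T) k :
  count P (u ++ flatten (nseq k v) ++ x ++ flatten (nseq k y) ++ z) =
  count P (u ++ x ++ z) + k * count P (v ++ y).
Proof.
have countX w : count P (flatten (nseq k w)) = k * count P w.
  by elim: k => //= k IH; rewrite count_cat IH mulSn.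
by rewrite !count_cat !countX; lia.
Qed.

(** * Towers of quantifiers and their acyclicity *)

Definition tower (l : seq nat) : formula := foldr FAll FBot l.

Lemma subformula_at_tower l p g : subformula_at (tower l) p = Some g ->
  exists2 i, p = nseq i false & g = tower (drop i l).
Proof.
elim: l p => [|x l IH] [|[] p] //=.
- by case=> <-; exists 0.
- by case=> <-; exists 0.
- by case/IH=> i -> ->; exists i.+1.
Qed.

Lemma subformula_at_tower_nseq l i : i <= size l ->
  subformula_at (tower l) (nseq i false) = Some (tower (drop i l)).
Proof. by elim: l i => [|x l IH] [|i] //= /IH. Qed.

Lemma quantifier_over_tower l i j :
  j <= i < size l -> quantifier_over (tower l) (nth 0 l j) (nseq j false) (nseq i false).
Proof.
case/andP=> ji il; split.
  by rewrite -(subnKC ji) nseqD prefix_prefix.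
exists (tower (drop j.+1 l)).
have jl : j < size l by lia.
by rewrite subformula_at_tower_nseq 1?ltnW // (drop_nth 0).
Qed.

Lemma occurs_at_tower l i :
  i < size l -> occurs_at (tower l) (nth 0 l i) (nseq i false).
Proof.
move=> il; exists (tower (drop i l)); first exact/subformula_at_tower_nseq/ltnW.
by rewrite (drop_nth 0) //= inE.
Qed.

Lemma occurs_at_towerP l x p : occurs_at (tower l) x p ->
  exists i, [/\ i < size l, p = nseq i false & x = nth 0 l i].
Proof.
case=> _ /subformula_at_tower[i -> ->].
have [li | il] := leqP (size l) i; first by rewrite drop_oversize.
by rewrite (drop_nth 0) //= inE => /eqP ->; exists i.
Qed.

(** Suppose positions [i < j] carry the same variable. The occurrence at [j] is bound, so one
    quantifier [q] binds both; it lies at depth at most [i] because its scope contains [i], and at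
    least [j] because it is innermost for [j]. *)
Lemma acyclic_tower_uniq l : acyclic (tower l) -> uniq l.
Proof.
case=> ub _; apply/(uniqPn 0) => -[i [j [ij jl eij]]].
have il : i < size l by apply: ltn_trans jl.
have occ_i := occurs_at_tower il; have occ_j := occurs_at_tower jl.
have qj : quantifier_over (tower l) (nth 0 l j) (nseq j false) (nseq j false).
  by apply: quantifier_over_tower; rewrite leqnn.
rewrite eij in occ_i; case: (ub (nth 0 l j)) => [free | [q bound]].
  exact: free occ_j _ qj.
have [[q_i _] _] := bound _ occ_i; have [_ /(_ _ qj) j_q] := bound _ occ_j.
by have := leq_trans (size_prefix j_q) (size_prefix q_i); rewrite !size_nseq leqNgt ij.
Qed.

Lemma uniq_acyclic_tower l : uniq l -> acyclic (tower l).
Proof.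
move=> ul; split=> [x | [n [x [p [n_gt0 _ _ /(_ 0 n_gt0)]]]]].
  (* For [x] outside [l] this address is a dummy: there is no occurrence to bind. *)
  right; exists (nseq (index x l) false) => p.
  move=> /occurs_at_towerP[i [il -> ->]]; rewrite index_uniq //; split.
    by apply: quantifier_over_tower; rewrite leqnn.
  by move=> q [].
(* The first edge of a cycle already needs an equality or membership atom. *)
by case=> _ /subformula_at_tower[i _ ->]; case: drop => [|y l'] [|[|[]]].
Qed.

(** * Symbol counts of towers *)

Definition foreign_to_towers : pred symbol := [in [:: Arrow; DotEq; In]].

(** Every constructor other than [FBot] and [FAll] prints a foreign symbol. Pumping introduces no
    new symbols, so pumped formulae remain towers. *)
Lemma tower_of_has_foreign f :
  ~~ has foreign_to_towers (string_of f) -> exists l, f = tower l.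
Proof.
elim: f => [|x y|x y|x f IH|f _ g _] /=.
- by exists [::].
- by rewrite has_cat /= !orbT.
- by rewrite has_cat /= !orbT.
- by rewrite has_cat /= negb_or => /andP[_ /IH[l ->]]; exists (x :: l).
- by rewrite has_cat /= !orbT.
Qed.

Lemma has_foreign_tower l : has foreign_to_towers (string_of (tower l)) = false.
Proof.
elim: l => //= x l IH; rewrite has_cat /= IH.
by rewrite has_nseq andbF.
Qed.

Lemma count_W_tower l : count_mem W (string_of (tower l)) = size l.
Proof.
by elim: l => //= x l IH; rewrite count_cat /= IH count_nseq mul0n.
Qed.

Lemma count_Star_tower l : count_mem Star (string_of (tower l)) = sumn l.
Proof.
by elim: l => //= x l IH; rewrite count_cat /= IH count_nseq mul1n.
Qed.

Lemma size_string_of_tower l : size (string_of (tower l)) = (4 * size l + sumn l).+1.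
Proof.
by elim: l => //= x l IH; rewrite size_cat /= IH size_nseq; lia.
Qed.

(** By pigeonhole, [n.+1] distinct numbers include some [x >= n]; removing it leaves the case [n],
    and the binomial grows by exactly [n]. *)
Lemma uniq_sumn_ge (l : seq nat) : uniq l -> 'C(size l, 2) <= sumn l.
Proof.
move en: (size l) => n; elim: n l en => [|n IH] l en ul; first by rewrite bin0n.
have /hasP[x xl nx] : has (leq n) l.
  apply/negPn/negP => /hasPn small.
  suff : size l <= size (iota 0 n) by rewrite size_iota en ltnn.
  by apply: uniq_leq_size => // x /small; rewrite mem_iota -ltnNge.
have := IH (rem x l); rewrite size_rem // en rem_uniq // => /(_ erefl isT) le.
rewrite (perm_sumn (perm_to_rem xl)) /= binS bin1.
by rewrite addnC leq_add.
Qed.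

Lemma sumn_iota0 m : sumn (iota 0 m) = 'C(m, 2).
Proof.
elim: m => [|m IH]; first by rewrite bin0n.
by rewrite -addn1 iotaD sumn_cat /= IH addn0 add0n addn1 binS bin1.
Qed.

Theorem mainTheorem5 : ~ context_free acyclic_formulae.
Proof.
move=> /context_free_pumping[N pump].
have acc : acyclic_formulae (string_of (tower (iota 0 N))).
  by exists (tower (iota 0 N)) => //; apply/uniq_acyclic_tower/iota_uniq.
have long : N < size (string_of (tower (iota 0 N))).
  by rewrite size_string_of_tower size_iota; lia.
have {pump acc long} [u [v [x [y [z [es vy pumped]]]]]] := pump _ acc long.
have count1 P : count P (string_of (tower (iota 0 N))) =
    count P (u ++ x ++ z) + count P (v ++ y).
  by rewrite es !count_cat; lia.
have towers k : exists2 l, uniq l &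
    u ++ flatten (nseq k v) ++ x ++ flatten (nseq k y) ++ z =
    string_of (tower l).
  have [f ef af] := pumped k.
  suff [l fl] : exists l, f = tower l.
    by exists l; rewrite -?fl //; apply: acyclic_tower_uniq; rewrite -fl.
  apply: tower_of_has_foreign; rewrite -ef has_count count_pumped.
  have /negbT := has_foreign_tower (iota 0 N).
  rewrite has_count -eqn0Ngt count1 addn_eq0 => /andP[/eqP -> /eqP ->].
  by rewrite muln0.
have [W0 | Wpos] := posnP (count_mem W (v ++ y)).
  (* Pumping down keeps [N] variables, so the result is no shorter than the original tower, although
     [v ++ y] was removed. *)
  have [l ul el] := towers 0; rewrite /= in el.
  have szl : size l = N.
    by rewrite -count_W_tower -el -[RHS](size_iota 0) -count_W_tower count1 W0 addn0.
  have := count1 predT; rewrite !count_predT el !size_string_of_tower.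
  have := uniq_sumn_ge ul; rewrite szl size_iota sumn_iota0.
  by case: (v ++ y) vy => //= *; lia.
(* With [k = 2c + 3] copies there are at least [k] variables, hence at least ['C(k, 2) = k(c + 1)]
   Stars; but there are at most [c + kc], and [c < k]. *)
pose c := count_mem Star (u ++ x ++ z) + count_mem Star (v ++ y).
have [l ul el] := towers (2 * c + 2).+1.
have := uniq_sumn_ge ul.
rewrite -count_W_tower -count_Star_tower -el !count_pumped.
have le : 'C((2 * c + 2).+1, 2) <= 'C(count_mem W (u ++ x ++ z) +
    (2 * c + 2).+1 * count_mem W (v ++ y), 2).
  by apply: leq_bin2l; rewrite -[leqLHS]muln1 (leq_trans _ (leq_addl _ _)) ?leq_mul.
move=> /(leq_trans le); rewrite bin2 /=.
have -> : (2 * c + 2).+1 * (2 * c + 2) = ((2 * c + 2).+1 * (c + 1)).*2 by lia.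
rewrite doubleK mulnDr muln1 leqNgt => /negP; apply.
rewrite [ltnRHS]addnC -addSn leq_add //; last by rewrite leq_mul // leq_addl.
by rewrite ltnS (leq_trans (leq_addr (count_mem Star (v ++ y)) _)) // -/c; lia.
Qed.
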